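(* Let $W\in\mathcal{W}^{n}$ and let $A$ be a non-empty closed subset of $W$. If $(pq)\subset \operatorname{int}(A)$ for every pair of boundary points $p,q$ of $A$, then $A$ is strictly convex.
   Context: $\mathcal{W}^{n}$ is the class of $C^{\infty}$ complete simply connected $n$-dimensional Riemannian manifolds without conjugate points (every nontrivial Jacobi field along every geodesic vanishes at most once). In such a manifold $W$ any two distinct points $p,q$ are joined by a unique geodesic; $[pq]$ denotes the closed geodesic segment joining them and $(pq)=[pq]\setminus\{p,q\}$ the open one. A subset $S\subset W$ is convex if $[pq]\subset S$ for all $p,q\in S$. A closed set $A$ is strictly convex if it is convex and $(pq)\subset\operatorname{int}(A)$ for all distinct $p,q\in\partial A$. $\partial A$ and $\operatorname{int}(A)$ are the topological boundary and interior in $W$. *)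

(* Defs.v *)
(* MathComp-Analysis *)
From HB Require Import structures.
From mathcomp Require Import all_boot all_order all_algebra.
From mathcomp Require Import all_classical all_reals all_analysis.

Set Implicit Arguments.
Unset Strict Implicit.
Unset Printing Implicit Defensive.

Import Order.TTheory GRing.Theory Num.Theory.
Import numFieldNormedType.Exports.

Local Open Scope classical_set_scope.
Local Open Scope ring_scope.

Section smooth_functions.
Variables (R : realType) (n : nat) (V : normedModType R).
Implicit Types (f : 'rV[R]_n -> V) (U : set 'rV[R]_n).

Definition partial (i : 'I_n) f : 'rV[R]_n -> V := 'D_(delta_mx 0 i) f.

(* Only meant for open U: the derivatives are two-sided. *)
Fixpoint Ck_on (k : nat) U f : Prop :=
  (forall x, U x -> {for x, continuous f}) /\
  if k is k'.+1 then
    forall i, (forall x, U x -> derivable f x (delta_mx 0 i)) /\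
              Ck_on k' U (partial i f)
  else True.

Definition smooth_on U f : Prop := forall k, Ck_on k U f.

End smooth_functions.

(* [chart_inv] is meaningful only on the image of [chart_dom]. *)
Record chart (R : realType) (n : nat) (M : topologicalType) := Chart {
  chart_dom : set M;
  chart_fun :> M -> 'rV[R]_n;
  chart_inv : 'rV[R]_n -> M;
  chart_dom_open : open chart_dom;
  chart_img_open : open (chart_fun @` chart_dom);
  chart_funK : forall p, chart_dom p -> chart_inv (chart_fun p) = p;
  chart_continuous : forall p, chart_dom p -> {for p, continuous chart_fun};
  chart_inv_continuous :
    forall x, (chart_fun @` chart_dom) x -> {for x, continuous chart_inv} }.

Definition transition (R : realType) (n : nat) (M : topologicalType)
  (phi psi : chart R n M) : 'rV[R]_n -> 'rV[R]_n := psi \o chart_inv phi.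

(* Tangent vectors are coordinate row vectors and ['J f x] acts on the right:
   a vector with coordinates u in phi has coordinates
   u *m 'J (transition phi psi) (phi p) in psi.  [metric phi x] is the Gram
   matrix, in the chart phi, of the scalar product at the point of
   coordinates x. *)
Record riemannian_manifold (R : realType) (n : nat) := RiemannianManifold {
  space :> topologicalType;
  space_hausdorff : hausdorff_space space;
  space_second_countable : @second_countable space;
  atlas : set (chart R n space);
  atlas_cover : forall p : space, exists2 phi, atlas phi & chart_dom phi p;
  atlas_smooth : forall phi psi, atlas phi -> atlas psi ->
    smooth_on (phi @` (chart_dom phi `&` chart_dom psi)) (transition phi psi);
  metric : chart R n space -> 'rV[R]_n -> 'M[R]_n;
  metric_smooth : forall phi, atlas phi ->
    smooth_on (phi @` chart_dom phi) (metric phi);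
  metric_sym : forall phi p, atlas phi -> chart_dom phi p ->
    (metric phi (phi p))^T = metric phi (phi p);
  metric_posdef : forall phi p (u : 'rV[R]_n), atlas phi -> chart_dom phi p ->
    u != 0 -> 0 < (u *m metric phi (phi p) *m u^T) 0 0;
  metric_change : forall phi psi p, atlas phi -> atlas psi ->
    chart_dom phi p -> chart_dom psi p ->
    metric phi (phi p) = 'J (transition phi psi) (phi p) *m
      metric psi (psi p) *m ('J (transition phi psi) (phi p))^T }.

Section riemannian_geometry.
Variables (R : realType) (n : nat) (W : riemannian_manifold R n).
Implicit Types (phi psi : chart R n W) (x : 'rV[R]_n) (i j k l : 'I_n).
Implicit Types (gamma : R -> W) (p q : W) (A S : set W).

(* Gamma_ij^k *)
Definition christoffel phi i j k x : R :=
  let g a b := fun y => metric phi y a b in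
  2^-1 * \sum_l invmx (metric phi x) k l *
    (partial i (g j l) x + partial j (g i l) x - partial l (g i j) x).

(* R_ijk^l, with R(X,Y)Z = D_X D_Y Z - D_Y D_X Z - D_[X,Y] Z and
   R(e_i,e_j)e_k = \sum_l R_ijk^l e_l *)
Definition curvature phi i j k l x : R :=
  let G := christoffel phi in
  partial i (G j k l) x - partial j (G i k l) x +
  \sum_m (G j k m x * G i m l x - G i k m x * G j m l x).

(* Coordinates in phi of R(u,v)w at the point of coordinates x *)
Definition curvature_op phi x (u v w : 'rV[R]_n) : 'rV[R]_n :=
  \row_l \sum_i \sum_j \sum_k
    curvature phi i j k l x * u 0 i * v 0 j * w 0 k.

(* The coordinates of gamma' in phi; like all the coordinate expressions below,
   relevant only at times t such that gamma t is in the domain of phi *)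
Definition velocity phi gamma : R -> 'rV[R]_n := derive1 (phi \o gamma).

(* Covariant derivative along gamma of the vector field of coordinates Y *)
Definition covariant_derivative phi gamma (Y : R -> 'rV[R]_n) (t : R)
    : 'rV[R]_n :=
  derive1 Y t + \row_k \sum_i \sum_j
    christoffel phi i j k (phi (gamma t)) * velocity phi gamma t 0 i * Y t 0 j.

(* Affinely parametrized geodesics defined on the whole real line, constant
   ones included; in a complete manifold every geodesic is a restriction of
   such a geodesic. *)
Definition geodesic gamma : Prop :=
  continuous gamma /\
  forall phi t, atlas phi -> chart_dom phi (gamma t) ->
    [/\ derivable (phi \o gamma) t 1,
        derivable (velocity phi gamma) t 1 &
        covariant_derivative phi gamma (velocity phi gamma) t = 0].

Definition complete_manifold : Prop :=
  forall phi p (v : 'rV[R]_n), atlas phi -> chart_dom phi p ->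
    exists gamma, [/\ geodesic gamma, gamma 0 = p & velocity phi gamma 0 = v].

(* A vector field along gamma is given by its coordinates in every chart. *)
Definition field_along gamma (J : chart R n W -> R -> 'rV[R]_n) : Prop :=
  forall phi psi t, atlas phi -> atlas psi ->
    chart_dom phi (gamma t) -> chart_dom psi (gamma t) ->
    J psi t = J phi t *m 'J (transition phi psi) (phi (gamma t)).

Definition jacobi_field gamma (J : chart R n W -> R -> 'rV[R]_n) : Prop :=
  field_along gamma J /\
  forall phi t, atlas phi -> chart_dom phi (gamma t) ->
    let DJ := covariant_derivative phi gamma (J phi) in
    let v := velocity phi gamma t in
    [/\ derivable (J phi) t 1, derivable DJ t 1 &
        covariant_derivative phi gamma DJ t +
          curvature_op phi (phi (gamma t)) (J phi t) v v = 0].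

Definition vanishes_at gamma (J : chart R n W -> R -> 'rV[R]_n) (t : R) : Prop :=
  forall phi, atlas phi -> chart_dom phi (gamma t) -> J phi t = 0.

Definition no_conjugate_points : Prop :=
  forall gamma J, geodesic gamma -> jacobi_field gamma J ->
    (exists t, ~ vanishes_at gamma J t) ->
    forall s t, vanishes_at gamma J s -> vanishes_at gamma J t -> s = t.

(* When p and q are joined by a unique geodesic up to affine
   reparametrization, this is its arc from p to q. *)
Definition segment p q : set W :=
  [set x | exists gamma, [/\ geodesic gamma, gamma 0 = p, gamma 1 = q &
             exists2 t : R, 0 <= t <= 1 & gamma t = x]].

Definition open_segment p q : set W := segment p q `\` [set p; q].

Definition convex_subset S : Prop :=
  forall p q, S p -> S q -> segment p q `<=` S.

Definition boundary A : set W := closure A `\` A°.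

Definition strictly_convex A : Prop :=
  [/\ closed A, convex_subset A &
      forall p q, boundary A p -> boundary A q -> p != q ->
        open_segment p q `<=` A°].

End riemannian_geometry.

Definition simply_connected (R : realType) (T : topologicalType) : Prop :=
  [/\ [set: T] !=set0,
      forall p q : T, exists c : R -> T,
        [/\ {within `[0, 1], continuous c}, c 0 = p & c 1 = q] &
      forall c : R -> T, {within `[0, 1], continuous c} -> c 0 = c 1 ->
        exists H : R * R -> T,
          [/\ {within `[0, 1] `*` `[0, 1], continuous H},
              forall t, 0 <= t <= 1 -> H (0, t) = c t /\ H (1, t) = c 0 &
              forall s, 0 <= s <= 1 -> H (s, 0) = c 0 /\ H (s, 1) = c 0]].

(* The class $\mathcal{W}^n$ *)
Definition in_class_W (R : realType) (n : nat) (W : riemannian_manifold R n)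
    : Prop :=
  [/\ complete_manifold W, simply_connected R W & no_conjugate_points W].

(* Main.v *)
Require Import Defs.
From HB Require Import structures.
From mathcomp Require Import all_boot all_order all_algebra.
From mathcomp Require Import all_classical all_reals all_analysis.
From mathcomp Require Import ring lra.

Set Implicit Arguments.
Unset Strict Implicit.
Unset Printing Implicit Defensive.

Import Order.TTheory GRing.Theory Num.Theory.
Import numFieldNormedType.Exports.

Local Open Scope classical_set_scope.
Local Open Scope ring_scope.

(** The boundary is reached by leaving A along a geodesic.  Suppose that a
    geodesic gamma with gamma 0 and gamma 1 in A has gamma t outside A for
    some t in [0, 1].  The arcs gamma [0, t] and gamma [t, 1] are connected
    and each of them meets both A and its complement, so each contains a
    boundary point of A ([path_meets_boundary]), say gamma a and gamma b.
    Boundary points of the closed set A lie in A, whence a < t < b, and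
    gamma t is neither gamma a nor gamma b.  The restriction of gamma to
    [a, b], affinely reparametrized, is a geodesic arc from gamma a to gamma b
    ([geodesic_segment]), so gamma t lies in an open segment between two
    boundary points, hence in the interior of A: a contradiction.

    The differential-geometric content is thus that the geodesic equation is
    invariant under affine changes of the parameter
    ([geodesic_affine_comp]). *)

Lemma is_derive_affine_comp (R : realType) (V : normedModType R) (f : R -> V)
    (a c s : R) :
  derivable f (a + c * s) 1 ->
  is_derive s 1 (fun u => f (a + c * u)) (c *: derive1 f (a + c * s)).
Proof.
move=> /derivable1_diffP df.
pose h : R -> R := cst a + c *: id.
have dh : is_derive s 1 h c.
  by apply: is_derive_eq; rewrite add0r [_ *: _]mulr1.
have Dh : differentiable h s by apply/derivable1_diffP; case: dh.
have -> : (fun u => f (a + c * u)) = f \o h by [].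
have Dfh : differentiable (f \o h) s by exact: differentiable_comp.
apply: DeriveDef; first exact/derivable1_diffP.
rewrite -derive1E derive1E'// diff_comp//= !diff1E//= scale1r.
by rewrite derive1E (@derive_val _ _ _ _ _ _ _ dh).
Qed.

(** Velocity scales by c, and both terms of the geodesic equation scale by c^2:
    the Christoffel term because it is quadratic in the velocity. *)
Lemma geodesic_affine_comp (R : realType) (n : nat)
    (W : riemannian_manifold R n) (gamma : R -> W) (a c : R) :
  geodesic gamma -> geodesic (fun s => gamma (a + c * s)).
Proof.
move=> [cg geo]; pose h : R -> R := fun s => a + c * s.
have ch : continuous h.
  by move=> s; apply: cvgD; [exact: cvg_cst|apply: cvgMr; exact: cvg_id].
have cgh : continuous (gamma \o h).
  by move=> s; apply: continuous_comp; [exact: ch|exact: cg].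
split=> // phi t phiA phit.
have vel s : chart_dom phi (gamma (h s)) ->
    is_derive s 1 (phi \o (gamma \o h)) (c *: velocity phi gamma (h s)).
  by move=> dom; have [d _ _] := geo _ _ phiA dom; exact: is_derive_affine_comp.
(* Differentiating the velocity once more requires its value on a whole
   neighbourhood of t, on which gamma \o h has to stay in the chart domain. *)
have nvel : \near t, c *: velocity phi gamma (h t)
    = velocity phi (gamma \o h) t.
  have : \near t, chart_dom phi ((gamma \o h) t).
    exact: (cgh t _ (open_nbhs_nbhs (conj (chart_dom_open phi) phit))).
  apply: filterS => s /vel ds.
  by rewrite [RHS]derive1E (@derive_val _ _ _ _ _ _ _ ds).
have [_ dv /= cov] := geo _ _ phiA phit.
have acc : is_derive t 1 (velocity phi (gamma \o h))
    (c *: (c *: derive1 (velocity phi gamma) (h t))).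
  apply: near_eq_is_derive nvel _.
  by apply: is_deriveZ; exact: is_derive_affine_comp.
split; [by case: (vel _ phit)|by case: acc|].
rewrite /covariant_derivative derive1E (@derive_val _ _ _ _ _ _ _ acc).
rewrite -(nbhs_singleton nvel).
rewrite -[RHS](scaler0 _ (c * c)) -cov scalerDr scalerA; congr +%R.
apply/rowP => k; rewrite !mxE mulr_sumr; apply: eq_bigr => i _.
rewrite mulr_sumr; apply: eq_bigr => j _; rewrite !mxE.
by rewrite /h; ring.
Qed.

(** If B misses the boundary of A, then B `&` A coincides with B `&` A°, so it
    is both open and closed in B; connectedness leaves only B itself. *)
Lemma connected_meets_boundary (R : realType) (n : nat)
    (W : riemannian_manifold R n) (A B : set W) (x y : W) :
  connected B -> closed A -> B x -> A x -> B y -> ~ A y ->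
  exists2 z, B z & boundary A z.
Proof.
move=> cB cA Bx Ax By nAy; apply: contrapT => nobd.
have inA z : B z -> A z -> A° z.
  move=> Bz Az; apply: contrapT => nz; apply: nobd; exists z => //.
  by split=> //; exact: subset_closure.
have E : B `&` A = B.
  apply: cB; [by exists x| |by exists A].
  exists A°; first exact: open_interior.
  apply/seteqP; split=> z [Bz Az]; split=> //; first exact: inA.
  exact: interior_subset.
by apply: nAy; move: By; rewrite -E => -[].
Qed.

(** The point inside A may come before or after the point outside, so that the
    two arcs on either side of a point outside A are treated alike. *)
Lemma path_meets_boundary (R : realType) (n : nat)
    (W : riemannian_manifold R n) (A : set W) (gamma : R -> W) (a b s t : R) :
  continuous gamma -> closed A -> s \in `[a, b] -> t \in `[a, b] ->
  A (gamma s) -> ~ A (gamma t) ->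
  exists2 u, u \in `[a, b] & boundary A (gamma u).
Proof.
move=> cg cA sab tab As nAt.
have cB : connected (gamma @` [set` `[a, b]]).
  apply: connected_continuous_connected; first exact: segment_connected.
  exact: continuous_subspaceT.
have [] := connected_meets_boundary cB cA _ As _ nAt; [by exists s|by exists t|].
by move=> _ [u uab <-]; exists u.
Qed.

Lemma geodesic_segment (R : realType) (n : nat) (W : riemannian_manifold R n)
    (gamma : R -> W) (a t b : R) :
  geodesic gamma -> a < t -> t < b -> segment (gamma a) (gamma b) (gamma t).
Proof.
move=> geo lt_at lt_tb; have lt_ab := lt_trans lt_at lt_tb.
exists (fun s => gamma (a + (b - a) * s)); split.
- exact: geodesic_affine_comp.
- by rewrite mulr0 addr0.
- by rewrite mulr1 addrC subrK.
- exists ((t - a) / (b - a)); last by congr gamma; field; lra.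
  by rewrite divr_ge0 ?ler_pdivrMr ?mul1r; lra.
Qed.

Theorem theorem4 (R : realType) (n : nat) (W : riemannian_manifold R n)
  (A : set W) (hW : in_class_W W) (hA0 : A !=set0) (hA : closed A)
  (hseg : forall p q : W, boundary A p -> boundary A q ->
    open_segment p q `<=` A°) :
  strictly_convex A.
Proof.
split=> //; last by move=> p q bp bq _; exact: hseg.
move=> p q Ap Aq _ [gamma [geo g0 g1 [t /andP[t0 t1] <-]]].
rewrite -g0 in Ap; rewrite -g1 in Aq.
apply: contrapT => nAt; have [cg _] := geo.
have bdA z : boundary A z -> A z by move=> [+ _]; rewrite -(closure_id A).1.
have [a /itvP a0t bda] : exists2 a, a \in `[0, t] & boundary A (gamma a).
  by apply: path_meets_boundary Ap nAt; rewrite // in_itv/= ?lexx ?t0.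
have [b /itvP bt1 bdb] : exists2 b, b \in `[t, 1] & boundary A (gamma b).
  by apply: path_meets_boundary Aq nAt; rewrite // in_itv/= ?lexx ?t1.
have neqt u : boundary A (gamma u) -> u != t.
  by move=> bdu; apply/eqP => ut; apply: nAt; rewrite -ut; exact: bdA.
have lt_at : a < t by rewrite lt_neqAle neqt ?a0t.
have lt_tb : t < b by rewrite lt_neqAle eq_sym neqt ?bt1.
apply: (nAt); apply: interior_subset; apply: (hseg _ _ bda bdb).
split; first exact: geodesic_segment.
by case=> /= E; apply: (nAt); rewrite E; exact: bdA.
Qed.
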